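(* Let $F$ be a probability distribution on $[0,\infty)$ with mean $\mu$, and denote $h(x)=F(x,x+1]$. Suppose $F\in\mathscr{L}_{\Delta(t)}$ for all $t\in(0,\infty)$, $\mu<\infty$, $\overline{F}^2(x/2)=o(F(x,x+1])$ as $x\to\infty$, and for all $y>0$, $$\limsup_{x\to\infty}\frac{h(xy)}{h(x)}<\infty .$$ Then $F\in\mathscr{S}_2$.
   Context: For a distribution $F$ on $[0,\infty)$: $\overline{F}(x)=1-F(x)$, $\overline{F}^2(x)=(\overline{F}(x))^2$, $F(a,b]=F(b)-F(a)$, and $F^{n*}=F^{*n}$ is the $n$-fold convolution of $F$. For $t\in(0,\infty)$ put $\Delta(t)=(0,t]$ and $F(x+\Delta(t))=F(x,x+t]$. $a(x)\sim b(x)$ means $\lim_{x\to\infty}a(x)/b(x)=1$; $a(x)=o(b(x))$ means $\lim_{x\to\infty}a(x)/b(x)=0$. $F\in\mathscr{L}_{\Delta(t)}$ (local long-tailed) if $F(x+y+\Delta(t))\sim F(x+\Delta(t))$ as $x\to\infty$, uniformly in $y\in[0,1]$. $F\in\mathscr{S}_{\Delta(t)}$ (local subexponential) if $F\in\mathscr{L}_{\Delta(t)}$ and $F^{*2}(x+\Delta(t))\sim 2F(x+\Delta(t))$ as $x\to\infty$. $F\in\mathscr{S}_2$ (second order subexponential) if $F$ is a distribution on $[0,\infty)$ with finite mean $\mu$, $F\in\mathscr{S}_{\Delta(t)}$ for all $t\in(0,\infty)$, and $\overline{F^{2*}}(x)-2\overline{F}(x)\sim 2\mu F(x,x+1]$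 as $x\to\infty$. *)

(* Defs.v *)
From HB Require Import structures.
From mathcomp Require Import all_boot all_order all_algebra.
From mathcomp Require Import all_classical all_reals all_analysis.
Import Order.TTheory GRing.Theory Num.Theory.
Import numFieldNormedType.Exports.

Set Implicit Arguments.
Unset Strict Implicit.
Unset Printing Implicit Defensive.

Local Open Scope classical_set_scope.
Local Open Scope ring_scope.

(* The limit of a quotient uses x / 0 = 0. A limit 1 therefore forces the
   denominator to be eventually nonzero. *)
Definition asymp_equiv (R : realType) (a b : R -> R) : Prop :=
  a x / b x @[x --> +oo] --> (1 : R).

(* Here a denominator that vanishes near +oo would make the condition void;
   the notion is only meant for an eventually nonzero b. *)
Definition asymp_negligible (R : realType) (a b : R -> R) : Prop :=
  a x / b x @[x --> +oo] --> (0 : R).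

Section addition_map.
Context {R : realType}.

Definition add_pair (z : measurableTypeR R * measurableTypeR R) :
  measurableTypeR R := (z.1 : R) + (z.2 : R).

Lemma measurable_add_pair : measurable_fun [set: _] add_pair.
Proof.
by apply: measurable_realfun.measurable_funD; [exact: measurable_fst | exact: measurable_snd].
Qed.

HB.instance Definition _ :=
  isMeasurableFun.Build _ _ _ _ add_pair measurable_add_pair.

End addition_map.

Section distributions.
Context {R : realType}.
Implicit Types (F G : probability (measurableTypeR R) R) (a b x t : R).

Definition on_nonneg F : Prop := F `[0%R, +oo[%classic = 1%E.

Definition distribution_function F x : R := fine (F `]-oo, x]%classic).

Definition tail F x : R := 1 - distribution_function F x.

(* F(a, b] *)
Definition mass F a b : R :=
  distribution_function F b - distribution_function F a.

(* F(x + Delta(t)) with Delta(t) = (0, t] *)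
Definition local_mass F t x : R := mass F x (x + t).

(* Meant for F on [0, +oo[, where the integral is well defined in [0, +oo]. *)
Definition mean F : \bar R := 'E_F[idfun].

(* The law of X + Y for independent X ~ F and Y ~ G. *)
Definition convolution F G : probability (measurableTypeR R) R :=
  distribution (F \x G)%E add_pair.

(* Convergence in x, uniform in y on [0, 1]; the limit 1 makes
   F(x + Delta(t)) nonzero for all large x. *)
Definition local_long_tailed F t : Prop :=
  {uniform `[0%R, 1%R]%classic,
    (fun x y => local_mass F t (x + y) / local_mass F t x) @ +oo --> (cst 1 : R -> R)}.

Definition local_subexponential F t : Prop :=
  local_long_tailed F t /\
  asymp_equiv (local_mass (convolution F F) t)
              (fun x => 2 * local_mass F t x).

Definition second_order_subexponential F : Prop :=
  [/\ on_nonneg F,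
      (mean F < +oo)%E,
      forall t, 0 < t -> local_subexponential F t &
      asymp_equiv (fun x => tail (convolution F F) x - 2 * tail F x)
                  (fun x => 2 * fine (mean F) * mass F x (x + 1))].

End distributions.

(* Main.v *)
Require Import Defs.
From mathcomp Require Import all_boot all_order all_algebra.
From mathcomp Require Import all_classical all_reals all_analysis.
From mathcomp Require Import measurable_realfun lra ring.
Import Order.TTheory GRing.Theory Num.Theory.
Import numFieldNormedType.Exports.

(** Write T for the tail of F, h x = F(x, x+1], mu for the mean and T2 for the
    tail of F * F. Splitting {X + Y > x}, for independent X and Y of law F,
    according to whether X <= x/2, Y <= x/2, or both exceed x/2 gives
      T2(x) - 2 T(x)
        = 2 int_{y <= x/2} F(x-y, x] dF(y) - 2 T(x) T(x/2) + T(x/2)^2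
    ([tail_convolutionB]). By assumption T(x/2)^2 = o(h(x)), and
    T(x) T(x/2) <= T(x/2)^2 for x >= 0, so everything rests on showing that
    the integral is equivalent to mu h(x) ([integral_mass_left]). This is
    dominated convergence for the integrand F(x-y, x] / h(x), with two
    ingredients.

    Pointwise limit. F(x-y, x] / h(x) tends to y ([mass_left_ratio]).
    Long-tailedness of the masses of intervals of length 1/n shows that the k
    consecutive intervals of length 1/n starting at x have asymptotically equal
    masses, so F(x, x+k/n] / h(x) tends to k/n; monotonicity in the length of
    the interval extends this from rationals to reals.

    Domination. F(x-y, x] <= C (y+1) h(x) for 0 <= y <= x/2
    ([mass_left_bound]), which is integrable in y because mu is finite. Covering
    ]x-y, x] by at most y+1 unit intervals, this follows from h(z) <= C h(x)
    for x/4 <= z <= x, uniformly in z ([bounded_ratio_uniform]). The assumption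
    on limsup h(xy)/h(x) only gives such a bound for each ratio y separately,
    with constants that depend on y; it becomes uniform by a Baire category
    argument on log y, in which bounds pass to limits of ratios because h,
    by long-tailedness, is nearly constant on unit intervals.

    Finally, the local subexponentiality of F comes for free from the second
    order statement: F*F(x, x+t] - 2 F(x, x+t] is the difference of T2 - 2 T
    between x and x + t, and both values are 2 mu h(x) + o(h(x))
    ([local_subexponential_of_excess]). *)

Set Implicit Arguments.
Unset Strict Implicit.
Unset Printing Implicit Defensive.

Local Open Scope classical_set_scope.
Local Open Scope ring_scope.

(** * Uniform bounds for ratios *)

Section bounded_ratios.
Context {R : realType} (h : R -> R) (X0 : R).
Hypothesis h_ge0 : forall x, 0 <= h x.
Hypothesis h_slow : forall x z, X0 <= x -> X0 <= z -> `|x - z| <= 1 ->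
  h z <= 2 * h x.
Hypothesis h_ratio : forall y, 0 < y -> exists M, \forall x \near +oo,
  h (x * y) <= M * h x.

(** Working with log-ratios s makes the sets cover a complete space, the whole
    line, and lets ratios near 1 be obtained by translating a ball to 0. *)
Let E n := [set s : R | forall x, n%:R <= x -> h (x * expR s) <= n%:R * h x].

Let E_cover : \bigcup_n E n = setT.
Proof.
rewrite -subTset => s _.
have [M [A [Ar hM]]] := h_ratio (expR_gt0 s).
pose n := (Num.truncn `|A| + Num.truncn `|M|).+1.
have An : A < n%:R.
  rewrite (le_lt_trans (ler_norm A))// (lt_le_trans (truncnS_gt _))//.
  by rewrite ler_nat ltnS leq_addr.
have Mn : M <= n%:R.
  rewrite (le_trans (ler_norm M))// (le_trans (ltW (truncnS_gt _)))//.
  by rewrite ler_nat ltnS leq_addl.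
exists n => // x nx; rewrite (le_trans (hM x _)) ?ler_wpM2r//.
exact: lt_le_trans nx.
Qed.

(** For fixed x, limit points of E n give the same bound up to the factor 2:
    if u is close to s then x e^u and x e^s are at distance at most 1. *)
Let closure_E n s x : n%:R <= x -> X0 + 1 <= x * expR s ->
  closure (E n) s -> h (x * expR s) <= 2 * n%:R * h x.
Proof.
move=> nx X0s clE.
have : (x * expR u) @[u --> s] --> x * expR s.
  by apply: cvgMr; exact: continuous_expR.
move=> /cvgr_dist_le/(_ _ ltr01) /clE[u [Eu ux]].
move: ux => /=; rewrite ler_norml => /andP[ux1 ux2].
rewrite (le_trans (h_slow (x := x * expR u) _ _ _))//; first lra.
- lra.
- by rewrite ler_norml; apply/andP; split; lra.
- by rewrite -mulrA ler_pM2l//; exact: Eu.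
Qed.

(** Otherwise the complements of the closures would be countably many dense open
    sets with empty intersection. *)
Let E_somewhere_dense : exists n s0 d, 0 < d /\
  forall s, `|s - s0| < d -> closure (E n) s.
Proof.
have [n] : exists n, ~ dense (~` closure (E n)).
  apply/existsNP => alld.
  have /(@Baire R R^o) : forall n,
      open (~` closure (E n)) /\ dense (~` closure (E n)).
    by move=> n; split => //; apply: closed_openC; exact: closed_closure.
  move=> /(_ setT) []; [by exists 0|exact: openT|].
  move=> s [_ /= bs].
  have [n _ Ens] : (\bigcup_n E n) s by rewrite E_cover.
  exact: (bs n I (subset_closure Ens)).
move=> /existsNP[U] /not_implyP[[s0 Us0]] /not_implyP[oU UE].
have /nbhs_ballP[d /= d0 dU] : nbhs s0 U by exact: open_nbhs_nbhs.
exists n, s0, d; split => // s sd; apply: contrapT => nEs.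
by apply: UE; exists s; split => //; apply: dU; rewrite /ball/= distrC.
Qed.

(** The ball around s0 is moved to 0 by going from x to x e^(-s0) first, at the
    cost of the bound for the single ratio e^(-s0). *)
Let ratio_near1 : exists d K X, [/\ 0 < d, 1 <= K, 0 < X &
  forall s x, - d <= s -> s <= 0 -> X <= x -> h (x * expR s) <= K * h x].
Proof.
have [n [s0 [d [d0 dE]]]] := E_somewhere_dense.
have [M [A [Ar hM]]] := h_ratio (expR_gt0 (- s0)).
pose e := expR (- s0).
have e0 : 0 < e by exact: expR_gt0.
(* Each summand of X serves one of the requirements x > A, n <= x e and
   X0 + 1 <= x e^s for s >= - d / 2. *)
pose X := 1 + `|A| + n%:R / e + (`|X0| + 1) * expR (d / 2).
have X_ge0 : 0 <= `|A| /\ 0 <= n%:R / e /\ 0 <= (`|X0| + 1) * expR (d / 2).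
  split; [exact: normr_ge0|split]; first by rewrite divr_ge0// ltW.
  by rewrite mulr_ge0 ?addr_ge0 ?expR_ge0.
exists (d / 2), (1 + 2 * n%:R * `|M|), X; split.
- lra.
- by rewrite lerDl !mulr_ge0.
- by rewrite /X; lra.
move=> s x ds s_le0 Xx.
have xexs : x * expR s = x * e * expR (s0 + s).
  by rewrite -mulrA -expRD addrA addNr add0r.
have nxe : n%:R <= x * e.
  by rewrite -ler_pdivrMr//; move: Xx; rewrite /X; lra.
have xs : X0 + 1 <= x * expR s.
  rewrite (@le_trans _ _ (`|X0| + 1))//; first by rewrite lerD2r ler_norm.
  have -> : s = - (- s) by rewrite opprK.
  rewrite [expR (- _)]expRN ler_pdivlMr ?expR_gt0//.
  have : (`|X0| + 1) * expR (- s) <= (`|X0| + 1) * expR (d / 2).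
    by rewrite ler_wpM2l ?addr_ge0// ler_expR; lra.
  move: Xx; rewrite /X; lra.
rewrite xexs (le_trans (closure_E nxe _ _))//; first by rewrite -xexs.
  by apply: dE; rewrite (addrC s0) addrK ltr_norml; apply/andP; split; lra.
have hxe : h (x * e) <= `|M| * h x.
  rewrite (le_trans (hM x _))//; last by rewrite ler_wpM2r// ler_norm.
  by move: Xx (ler_norm A); rewrite /X; lra.
have n2 : 0 <= 2 * n%:R :> R by rewrite mulr_ge0.
have := ler_wpM2l n2 hxe; have := h_ge0 x; lra.
Qed.

(** Ratios in [1/4, 1] are reached from 1 in boundedly many steps of log-size at
    most d, each of which costs a factor K. *)
Lemma bounded_ratio_uniform : exists C, 0 < C /\
  \forall x \near +oo, forall z, x / 4 <= z -> z <= x -> h z <= C * h x.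
Proof.
have [d [K [X [d0 K1 X0' hK]]]] := ratio_near1.
have K0 : 0 < K by exact: lt_le_trans K1.
have iter k x z : X <= z -> z <= x -> x <= z * expR (k%:R * d) ->
    h z <= K ^+ k * h x.
  elim: k z => [|k IH] z Xz zx.
    rewrite mul0r expR0 mulr1 => xz.
    by rewrite expr0 mul1r (_ : z = x)//; apply/eqP; rewrite eq_le zx xz.
  move=> xz; have z0 : 0 < z by exact: lt_le_trans Xz.
  have [xz1|zx1] := leP x (z * expR d).
    have x0 : 0 < x by exact: lt_le_trans zx.
    have -> : z = x * expR (ln (z / x)).
      by rewrite lnK ?posrE ?divr_gt0// mulrC divfK// gt_eqF.
    rewrite (le_trans (hK _ _ _ _ _))//.
    - rewrite -ler_expR lnK ?posrE ?divr_gt0// expRN ler_pdivlMr//.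
      by rewrite mulrC ler_pdivrMr ?expR_gt0.
    - by rewrite -ler_expR expR0 lnK ?posrE ?divr_gt0// ler_pdivrMr// mul1r.
    - exact: le_trans zx.
    - by rewrite ler_wpM2r// exprS ler_peMr ?exprn_ege1// ltW.
  have -> : z = z * expR d * expR (- d).
    by rewrite -mulrA -expRD subrr expR0 mulr1.
  have zd : X <= z * expR d.
    by rewrite (le_trans Xz)// ler_peMr ?ltW// -expR0 ltr_expR.
  rewrite (le_trans (hK _ _ _ _ _))//; first lra.
  rewrite exprS -mulrA ler_pM2l//; apply: IH => //; first exact: ltW.
  by rewrite -mulrA -expRD (le_trans xz)// ler_pM2l// ler_expR -natr1; lra.
pose k := (Num.truncn (ln (4 : R) / d)).+1.
exists (K ^+ k); split; first exact: exprn_gt0.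
near=> x => z xz zx; apply: iter => //.
  by rewrite (le_trans _ xz)// ler_pdivlMr//; near: x; exact: nbhs_pinfty_ge.
have : 4 <= expR (k%:R * d).
  rewrite -[leLHS](@lnK R) ?posrE// ler_expR -ler_pdivrMr//.
  by rewrite ltW// truncnS_gt.
have z0 : 0 <= z.
  by rewrite (le_trans _ xz)// divr_ge0//; near: x; exact: nbhs_pinfty_ge.
move=> /(ler_wpM2l z0); lra.
Unshelve. all: by end_near. Qed.

End bounded_ratios.

(** * Tails and interval masses *)

Section tail_theory.
Context {R : realType} (F : probability (measurableTypeR R) R).
Implicit Types x y a b t : R.

Lemma tailE x : (tail F x)%:E = F `]x, +oo[%classic.
Proof.
have -> : `]x, +oo[%classic = ~` `]-oo, x]%classic by rewrite setCitvl.
rewrite probability_setC// /tail /distribution_function EFinB fineK//.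
exact: fin_num_measure.
Qed.

Lemma tail_ge0 x : 0 <= tail F x.
Proof. by rewrite -lee_fin tailE. Qed.

Lemma tail_le1 x : tail F x <= 1.
Proof. by rewrite -lee_fin tailE probability_le1. Qed.

Lemma tail_nonincreasing x y : x <= y -> tail F y <= tail F x.
Proof.
move=> xy; rewrite -lee_fin !tailE le_measure ?inE//.
exact: subset_itvr.
Qed.

Lemma mass_tail a b : mass F a b = tail F a - tail F b.
Proof. by rewrite /mass /tail; ring. Qed.

Lemma mass_ge0 a b : a <= b -> 0 <= mass F a b.
Proof. by move=> ab; rewrite mass_tail subr_ge0 tail_nonincreasing. Qed.

Lemma local_mass_ge0 t x : 0 <= t -> 0 <= local_mass F t x.
Proof. by move=> t0; rewrite mass_ge0// lerDl. Qed.

End tail_theory.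

(** * Locally long-tailed distributions *)

Lemma cvg_near_eq (R : realType) (f g : R -> R) (a l : R) :
  f @ +oo --> a -> a = l -> (\forall x \near +oo, f x = g x) -> g @ +oo --> l.
Proof.
by move=> fa <- fg; move: fa; apply: cvg_trans; exact: near_eq_cvg.
Qed.

Section local_long_tailed_theory.
Context {R : realType} (F : probability (measurableTypeR R) R).
Hypothesis llF : forall t, 0 < t -> local_long_tailed F t.
Implicit Types x y a b t s : R.

Lemma local_mass_ratio_unif t e : 0 < t -> 0 < e ->
  \forall x \near +oo, forall s, 0 <= s <= 1 ->
    `|local_mass F t (x + s) / local_mass F t x - 1| < e.
Proof.
move=> t0 e0.
have := llF t0; rewrite /local_long_tailed => /(_ [set g | forall s,
  `[0%R, 1%R]%classic s -> `|g s - 1| < e]).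
have H : nbhs (cst 1 : {uniform` `[0%R, 1%R]%classic -> R}) [set g | forall s,
  `[0%R, 1%R]%classic s -> `|g s - 1| < e].
  apply/uniform_nbhs; exists [set xy : R * R | ball xy.1 e xy.2].
  split; first exact: (@entourage_ball _ R^o (PosNum e0)).
  by move=> g /= gP s s01; rewrite distrC; exact: gP.
move=> /(_ H) Hx; apply: (@filterS _ (+oo%R : set_system R) _ _ _ _ Hx).
move=> x xP s s01; apply: xP.
by rewrite /= in_itv.
Qed.

(** A zero denominator would make the quotient 0, too far from its limit 1. *)
Lemma local_mass_gt0 t : 0 < t -> \forall x \near +oo, 0 < local_mass F t x.
Proof.
move=> t0; apply: filterS (local_mass_ratio_unif t0 ltr01) => x /(_ 0).
rewrite lexx ler01 => /(_ isT) H.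
rewrite lt_neqAle local_mass_ge0 ?ltW// andbT; apply/eqP => m0.
by move: H; rewrite -m0 invr0 mulr0 sub0r normrN1 ltxx.
Qed.

(** Long-tailedness covers shifts in [0, 1]; larger ones are composed of unit
    shifts. *)
Lemma local_mass_shift t s : 0 < t -> 0 <= s ->
  (fun x : R => local_mass F t (x + s) / local_mass F t x) @ +oo --> (1 : R).
Proof.
move=> t0 s0.
suff {s s0} H (n : nat) s : 0 <= s <= n%:R ->
    (fun x : R => local_mass F t (x + s) / local_mass F t x) @ +oo --> (1 : R).
  by apply: (H (Num.truncn s).+1); rewrite s0 ltW// truncnS_gt.
elim: n s => [|n IH] s /andP[s0 sn].
  have -> : s = 0 by apply/eqP; rewrite eq_le s0 sn.
  apply: cvg_near_cst; apply: filterS (local_mass_gt0 t0) => x m0.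
  by rewrite addr0 divff// gt_eqF.
have [s1|s1] := leP s 1.
  apply/cvgrPdist_lt => e e0; apply: filterS (local_mass_ratio_unif t0 e0) => x.
  by move=> /(_ s); rewrite s0 s1 distrC => /(_ isT).
have Hn : (fun x : R => local_mass F t (x + (s - 1)) / local_mass F t x)
    @ +oo --> (1 : R).
  by apply: IH; move: sn; rewrite -natr1 => sn; apply/andP; split; lra.
have H1 : (fun x : R => local_mass F t (x + (s - 1) + 1) /
    local_mass F t (x + (s - 1))) @ +oo --> (1 : R).
  rewrite (cvg_shiftr (s - 1)
    (fun x => local_mass F t (x + 1) / local_mass F t x)).
  apply/cvgrPdist_lt => e e0; apply: filterS (local_mass_ratio_unif t0 e0) => x.
  by move=> /(_ 1); rewrite lexx ler01 distrC => /(_ isT).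
apply: (cvg_near_eq (cvgM H1 Hn)); first exact: mulr1.
near=> x; rewrite /= mulrA divfK; first by rewrite -addrA subrK.
by rewrite gt_eqF//; near: x; exact: (cvg_addrr (s - 1) (local_mass_gt0 t0)).
Unshelve. all: by end_near. Qed.

Let local_mass_multiple (k : nat) t : 0 < t ->
  (fun x : R => local_mass F (k%:R * t) x / local_mass F t x) @ +oo -->
  (k%:R : R).
Proof.
move=> t0; elim: k => [|k IH].
  apply: cvg_near_cst; near=> x.
  by rewrite mul0r /local_mass addr0 /mass subrr mul0r.
have kt0 : 0 <= k%:R * t by rewrite mulr_ge0// ltW.
apply: (cvg_near_eq (cvgD IH (local_mass_shift t0 kt0))); first exact: natr1.
near=> x.
rewrite /= fctE -mulrDl; congr (_ / _); rewrite /local_mass /mass.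
by rewrite -natr1 mulrDl mul1r !addrA; ring.
Unshelve. all: by end_near. Qed.

(** Intervals of length 1/n are the common unit: F(x, x+k/n] and h x are
    asymptotically k and n times their mass. Any length t lies between two
    consecutive multiples of 1/n, and masses increase with the length. *)
Lemma local_mass_ratio t : 0 <= t ->
  (fun x : R => local_mass F t x / local_mass F 1 x) @ +oo --> t.
Proof.
move=> t0.
have frac (n k : nat) : (0 < n)%N ->
    (fun x : R => local_mass F (k%:R / n%:R) x / local_mass F 1 x)
      @ +oo --> (k%:R / n%:R : R).
  move=> n0; have nR0 : 0 < n%:R^-1 :> R by rewrite invr_gt0 ltr0n.
  have n1 : n%:R * n%:R^-1 = 1 :> R by rewrite divff// pnatr_eq0 -lt0n.
  have n_neq0 : n%:R != 0 :> R by rewrite pnatr_eq0 -lt0n.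
  apply: (cvg_near_eq (cvgM (local_mass_multiple nR0)
    (cvgV n_neq0 (local_mass_multiple nR0)))) => //; near=> x.
  rewrite /= n1 invf_div mulrA divfK// gt_eqF//.
  by near: x; exact: local_mass_gt0.
apply/cvgrPdist_le => e e0.
pose n := (Num.truncn (2 / e)).+1; pose k := Num.truncn (t * n%:R).
have n0 : 0 < n%:R :> R by rewrite ltr0n.
have en : n%:R^-1 <= e / 2.
  by rewrite -[leRHS]invf_div lef_pV2 ?posrE ?divr_gt0// ltW// truncnS_gt.
have tn0 : 0 <= t * n%:R by rewrite mulr_ge0// ltW.
have kt : k%:R / n%:R <= t by rewrite ler_pdivrMr// truncn_le.
have tk : t <= k.+1%:R / n%:R by rewrite ler_pdivlMr// ltW// truncnS_gt.
have e20 : 0 < e / 2 by rewrite divr_gt0.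
have /cvgrPdist_le/(_ _ e20) fk := frac n k isT.
have /cvgrPdist_le/(_ _ e20) fk1 := frac n k.+1 isT.
near=> x.
have h0 : 0 < local_mass F 1 x by near: x; exact: local_mass_gt0.
have mono a b : a <= b ->
    local_mass F a x / local_mass F 1 x <= local_mass F b x / local_mass F 1 x.
  move=> ab; rewrite ler_pM2r ?invr_gt0// /local_mass !mass_tail.
  by rewrite lerD2l lerN2 tail_nonincreasing// lerD2l.
have : `|k%:R / n%:R - local_mass F (k%:R / n%:R) x / local_mass F 1 x|
    <= e / 2 by near: x.
have : `|k.+1%:R / n%:R - local_mass F (k.+1%:R / n%:R) x / local_mass F 1 x|
    <= e / 2 by near: x.
rewrite !ler_norml => /andP[a1 a2] /andP[b1 b2].
have := mono _ _ kt; have := mono _ _ tk.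
have kk : k.+1%:R / n%:R = k%:R / n%:R + n%:R^-1 :> R.
  by rewrite -natr1 mulrDl mul1r.
rewrite kk in a1 a2 tk * => c1 c2; apply/andP; split; lra.
Unshelve. all: by end_near. Qed.

Lemma mass_left_ratio y : 0 <= y ->
  (fun x : R => mass F (x - y) x / local_mass F 1 x) @ +oo --> y.
Proof.
move=> y0; rewrite -(cvg_shiftr y
  (fun x => mass F (x - y) x / local_mass F 1 x)).
apply: (cvg_near_eq (cvgM (local_mass_ratio y0)
  (cvgV (oner_neq0 _) (local_mass_shift ltr01 y0)))).
  by rewrite invr1 mulr1.
near=> x.
rewrite /= invf_div mulrA divfK ?addrK// gt_eqF//.
by near: x; exact: local_mass_gt0.
Unshelve. all: by end_near. Qed.

End local_long_tailed_theory.

(** * Domination of the interval masses *)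

Lemma limf_esup_lty_le (R : realType) (f : R -> R) :
  (limf_esup (EFin \o f) +oo%R < +oo)%E ->
  exists M : R, \forall x \near +oo, f x <= M.
Proof.
rewrite limf_esupE => /ereal_inf_lt[_ [V nV <-]] supV.
exists (fine (ereal_sup ((EFin \o f) @` V))); apply: filterS nV => x Vx.
have fle : ((f x)%:E <= ereal_sup ((EFin \o f) @` V))%E.
  by apply: ereal_sup_ubound; exists x.
rewrite -lee_fin fineK// fin_numE -ltey supV andbT.
by rewrite -ltNye (lt_le_trans _ fle)// ltNyr.
Qed.

Section domination.
Context {R : realType} (F : probability (measurableTypeR R) R).
Hypothesis llF : forall t, 0 < t -> local_long_tailed F t.
Let h : R -> R := local_mass F 1.
Hypothesis limsup_h : forall y : R, 0 < y ->
  (limf_esup (fun x : R => (h (x * y) / h x)%:E) +oo%R < +oo)%E.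

Let h_slow : exists X0, forall x z, X0 <= x -> X0 <= z -> `|x - z| <= 1 ->
  h z <= 2 * h x.
Proof.
have half0 : 0 < 2^-1 :> R by [].
have [A [_ hA]] : \forall x \near +oo, 0 < h x /\ forall s, 0 <= s <= 1 ->
    `|h (x + s) / h x - 1| < 2^-1.
  near=> x; split; near: x; first exact: local_mass_gt0.
  exact: local_mass_ratio_unif.
exists (A + 1) => x z Ax Az; rewrite ler_norml => /andP[xz1 xz2].
have close a b : A < a -> a <= b -> b <= a + 1 ->
    h b <= 2 * h a /\ h a <= 2 * h b.
  move=> Aa ab ba; have [ha0 /(_ (b - a))] := hA _ Aa.
  have -> : a + (b - a) = b by rewrite addrC subrK.
  have -> : 0 <= b - a <= 1 by apply/andP; split; lra.
  move=> /(_ isT); rewrite ltr_norml => /andP[lo up].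
  have {}lo : 2^-1 * h a < h b by rewrite -ltr_pdivlMr//; lra.
  have {}up : h b < 3 / 2 * h a by rewrite -ltr_pdivrMr//; lra.
  by split; lra.
have [xz|zx] := leP x z.
  by have [] := @close x z; lra.
by have [] := @close z x; lra.
Unshelve. all: by end_near. Qed.

Let h_ratio y : 0 < y -> exists M, \forall x \near +oo, h (x * y) <= M * h x.
Proof.
move=> y0; have [M hM] := limf_esup_lty_le (limsup_h y0).
exists M; near=> x; rewrite -ler_pdivrMr; last first.
  by near: x; exact: local_mass_gt0.
by near: x.
Unshelve. all: by end_near. Qed.

(** The bound grows linearly in y, hence is F-integrable as soon as F has finite
    mean. *)
Lemma mass_left_bound : exists C, 0 < C /\
  \forall x \near +oo, forall y, 0 <= y -> y <= x / 2 ->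
    mass F (x - y) x <= C * (y + 1) * h x.
Proof.
have [X0 slow] := h_slow.
have h_ge0 x : 0 <= h x by exact: local_mass_ge0.
have [C [C0 hC]] := bounded_ratio_uniform h_ge0 slow h_ratio.
exists C; split => //; near=> x => y y0 yx.
have x4 : 4 <= x by near: x; exact: nbhs_pinfty_ge.
have hCx : forall z, x / 4 <= z -> z <= x -> h z <= C * h x by near: x.
(* The n unit intervals that fill ]x - n, x] start at x / 4 or later, where h
   is comparable with h x. *)
have sum (n : nat) : n%:R <= x * (3 / 4) ->
    mass F (x - n%:R) x <= n%:R * (C * h x).
  elim: n => [|n IH]; first by rewrite subr0 mul0r /mass subrr.
  rewrite -natr1 => nx.
  have n0 : 0 <= n%:R :> R by [].
  have -> : mass F (x - (n%:R + 1)) x =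
      h (x - (n%:R + 1)) + mass F (x - n%:R) x.
    rewrite /h /local_mass /mass.
    have -> : x - (n%:R + 1) + 1 = x - n%:R by ring.
    by ring.
  have := IH ltac:(lra); have := hCx (x - (n%:R + 1)) ltac:(lra) ltac:(lra).
  lra.
pose n := (Num.truncn y).+1.
have yn : y <= n%:R by rewrite ltW// truncnS_gt.
have ny : n%:R <= y + 1 by rewrite -natr1 lerD2r truncn_le.
have := sum n ltac:(lra).
have : mass F (x - y) x <= mass F (x - n%:R) x.
  by rewrite !mass_tail lerD2r tail_nonincreasing//; lra.
have : n%:R * (C * h x) <= (y + 1) * (C * h x).
  by rewrite ler_wpM2r// mulr_ge0// ltW.
lra.
Unshelve. all: by end_near. Qed.

End domination.

(** * The tail of the convolution square *)

Section convolution_tail.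
Context {R : realType} (F : probability (measurableTypeR R) R).
Implicit Types x y : R.

Let low x : set R := `]-oo, x / 2]%classic.

Let measurable_low x : measurable (low x : set (measurableTypeR R)).
Proof. exact: measurable_itv. Qed.

(** The three parts of {z.1 + z.2 > x}: one coordinate is at most x / 2, in two
    ways that exclude each other, or none is, which forces the sum above x. *)
Let low_fst x : set (measurableTypeR R * measurableTypeR R) :=
  [set z | low x z.1 /\ x < z.1 + z.2].
Let low_snd x : set (measurableTypeR R * measurableTypeR R) :=
  [set z | low x z.2 /\ x < z.1 + z.2].
Let high x : set (measurableTypeR R * measurableTypeR R) :=
  `]x / 2, +oo[%classic `*` `]x / 2, +oo[%classic.

Let measurable_low_fst x : measurable (low_fst x).
Proof.
have -> : low_fst x = (low x `*` setT) `&`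
    (Defs.add_pair @^-1` `]x, +oo[%classic).
  apply/seteqP; split=> z; rewrite /low_fst /Defs.add_pair /= in_itv/= andbT.
    by move=> [].
  by move=> [[]].
apply: measurableI; first by apply: measurableX => //; exact: measurable_low.
by rewrite -[X in measurable X]setTI; exact: Defs.measurable_add_pair.
Qed.

Let measurable_low_snd x : measurable (low_snd x).
Proof.
have -> : low_snd x = (setT `*` low x) `&`
    (Defs.add_pair @^-1` `]x, +oo[%classic).
  apply/seteqP; split=> z; rewrite /low_snd /Defs.add_pair /= in_itv/= andbT.
    by move=> [].
  by move=> [[]].
apply: measurableI; first by apply: measurableX => //; exact: measurable_low.
by rewrite -[X in measurable X]setTI; exact: Defs.measurable_add_pair.
Qed.

Let xsection_low_fst x y : (F (xsection (low_fst x) y) =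
  ((fun y => (tail F (x - y))%:E) \_ (low x)) y)%E.
Proof.
rewrite patchE; case: ifPn => [|] yx.
  rewrite tailE; congr (F _); apply/seteqP; split => z.
    rewrite /xsection/= inE /low_fst/= in_itv/= andbT => -[_].
    by rewrite ltrBlDl.
  rewrite /xsection/= inE /low_fst/= in_itv/= andbT => xyz.
  by split; [exact: set_mem|rewrite -ltrBlDl].
rewrite -[RHS](measure0 F); congr (F _); apply/seteqP; split => z //.
rewrite /xsection/= inE => -[yl _].
by move/negP: yx; apply; exact: mem_set.
Qed.

Let integrable_low x : F.-integrable `]-oo, (x / 2)%R]
  (EFin \o (fun y => tail F (x - y))).
Proof.
apply: measurable_bounded_integrable => //.
- by rewrite (le_lt_trans (probability_le1 _ _))// ltry.
- apply: nondecreasing_measurable => // y z yz.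
  by apply: tail_nonincreasing; rewrite lerD2l lerN2.
- exists 1; split => // M M1 y _ /=; rewrite ger0_norm ?tail_ge0//.
  by rewrite (le_trans (tail_le1 _ _))// ltW.
Qed.

Lemma integrable_mass_left x : F.-integrable `]-oo, (x / 2)%R]
  (EFin \o (fun y => mass F (x - y) x)).
Proof.
have low_cst : F.-integrable `]-oo, (x / 2)%R] (EFin \o cst (tail F x)).
  exact: finite_measure_integrable_cst.
have := integrableB (measurable_low x) (integrable_low x) low_cst.
apply: eq_integrable => // y _ /=.
by rewrite mass_tail EFinB.
Qed.

Let integral_low x :
  (\int[F]_y ((fun y => (tail F (x - y))%:E) \_ (low x)) y)%E =
  (\int[F]_(y in `]-oo, (x / 2)%R]) tail F (x - y))%:E.
Proof.
rewrite -integral_mkcond /Rintegral fineK//.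
by apply: integrable_fin_num => //; exact: integrable_low.
Qed.

Let measure_low_fst x : (F \x F)%E (low_fst x) =
  (\int[F]_(y in `]-oo, (x / 2)%R]) tail F (x - y))%:E.
Proof.
rewrite -integral_low; apply: eq_integral => y _.
exact: xsection_low_fst.
Qed.

(** Integrating over the second coordinate first, by Tonelli, the sections are
    those of low_fst. *)
Let measure_low_snd x : (F \x F)%E (low_snd x) =
  (\int[F]_(y in `]-oo, (x / 2)%R]) tail F (x - y))%:E.
Proof.
transitivity (\int[F]_y (F \o xsection (low_snd x)) y)%E => //.
have := indic_fubini_tonelli F F (measurable_low_snd x).
rewrite indic_fubini_tonelli_FE// indic_fubini_tonelli_GE// => ->.
rewrite -integral_low; apply: eq_integral => y _.
rewrite -xsection_low_fst /=; congr (F _); apply/seteqP; split => z.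
  by rewrite /xsection /ysection/= !inE => -[yl]; rewrite addrC.
by rewrite /xsection /ysection/= !inE => -[yl]; rewrite addrC.
Qed.

Lemma tail_convolution x : tail (convolution F F) x =
  2 * \int[F]_(y in `]-oo, (x / 2)%R]) tail F (x - y) + tail F (x / 2) ^+ 2.
Proof.
apply: EFin_inj; rewrite tailE.
transitivity ((F \x F)%E (low_fst x `|` (low_snd x `|` high x))).
  congr ((F \x F)%E _); apply/seteqP; split => z.
    rewrite /Defs.add_pair/= in_itv/= andbT => xz.
    have [z1|z1] := leP z.1 (x / 2).
      by left; split => //; rewrite /low/= in_itv.
    have [z2|z2] := leP z.2 (x / 2).
      by right; left; split => //; rewrite /low/= in_itv.
    by right; right; split; rewrite /= in_itv/= andbT.
  rewrite /Defs.add_pair/= in_itv/= andbT => -[[]//|[[]//|]].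
  move=> [/=]; rewrite !in_itv/= !andbT => z1 z2.
  by rewrite [X in X < _](splitr x) ltrD.
have mhigh : measurable (high x) by exact: measurableX.
have fst_disjoint : low_fst x `&` (low_snd x `|` high x) = set0.
  apply/seteqP; split => // z [[z1 xz] []]; move: z1; rewrite /low /= in_itv/=.
    move=> z1 [z2 _]; move: z2; rewrite ?in_itv/= => z2.
    by move: xz; rewrite [X in X < _](splitr x) ltNge lerD.
  by move=> z1 [/=]; rewrite in_itv/= andbT ltNge z1.
have snd_disjoint : low_snd x `&` high x = set0.
  apply/seteqP; split => // z [[z2 _] [_]]; move: z2; rewrite /low /= !in_itv/=.
  by rewrite andbT ltNge => ->.
transitivity ((F \x F) (low_fst x) +
  ((F \x F) (low_snd x) + (F \x F) (high x)))%E.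
  rewrite -[X in (_ + X)%E]measureU//; apply: measureU => //.
  exact: measurableU.
have -> : (F \x F)%E (high x) = (tail F (x / 2) ^+ 2)%:E.
  by rewrite expr2 EFinM tailE; exact: product_measure1E.
rewrite measure_low_fst measure_low_snd -!EFinD; congr EFin; ring.
Qed.

(** The constant T(x) integrates over ]-oo, x/2] to T(x) (1 - T(x/2)): turning
    T(x-y) into F(x-y, x] therefore costs the cross term T(x) T(x/2). *)
Lemma tail_convolutionB x : tail (convolution F F) x - 2 * tail F x =
  2 * \int[F]_(y in `]-oo, (x / 2)%R]) mass F (x - y) x
  - 2 * tail F x * tail F (x / 2) + tail F (x / 2) ^+ 2.
Proof.
rewrite tail_convolution.
under [in RHS]eq_Rintegral do rewrite mass_tail.
have low_cst : F.-integrable `]-oo, (x / 2)%R] (EFin \o (fun=> tail F x)).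
  exact: finite_measure_integrable_cst.
rewrite (RintegralB _ (integrable_low x) low_cst)//.
rewrite Rintegral_cst//.
rewrite (_ : fine _ = 1 - tail F (x / 2)); first by ring.
by rewrite /tail opprB addrC subrK.
Qed.

End convolution_tail.

(** * Second order asymptotics *)

Section mean_theory.
Context {R : realType} (F : probability (measurableTypeR R) R).
Hypothesis F_nonneg : on_nonneg F.

Lemma ae_nonneg : {ae F, forall y : R, 0 <= y}.
Proof.
exists (~` `[0%R, +oo[%classic); split.
- exact: measurableC.
- by rewrite probability_setC// F_nonneg subee.
- by apply: subsetC => y /=; rewrite in_itv/= andbT.
Qed.

Lemma meanE : mean F = (\int[F]_y (`|y|)%:E)%E.
Proof.
rewrite /mean unlock; apply: ae_eq_integral => //.
- by apply/measurable_EFinP; exact: measurable_id.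
- by apply/measurable_EFinP; exact: normr_measurable.
apply: (@filterS _ _ (ae_filter_ringOfSetsType F) _ _ _ ae_nonneg) => y y0 _ /=.
by rewrite ger0_norm.
Qed.

(** Markov's inequality. *)
Lemma mean_ge_tail x : 0 <= x -> (x%:E * (tail F x)%:E <= mean F)%E.
Proof.
move=> x0; rewrite meanE tailE -integral_cst//.
rewrite integral_mkcond; apply: ge0_le_integral => //.
- by move=> y _; rewrite patchE; case: ifPn.
- apply/(measurable_restrictT _ _).1 => //.
- by apply/measurable_EFinP; exact: normr_measurable.
move=> y _; rewrite patchE; case: ifPn => [/set_mem|_]; last by rewrite lee_fin.
rewrite /= in_itv/= andbT => xy.
by rewrite lee_fin (le_trans (ltW xy))// ler_norm.
Qed.

Hypothesis mean_lty : (mean F < +oo)%E.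

Lemma integrable_id : F.-integrable setT (fun y : R => y%:E).
Proof.
apply/integrableP; split.
  by apply/measurable_EFinP; exact: measurable_id.
by move: mean_lty; rewrite meanE.
Qed.

End mean_theory.

Section second_order_asymptotics.
Context {R : realType} (F : probability (measurableTypeR R) R).
Hypothesis F_nonneg : on_nonneg F.
Hypothesis llF : forall t, 0 < t -> local_long_tailed F t.
Hypothesis mean_lty : (mean F < +oo)%E.
Let h : R -> R := local_mass F 1.
Hypothesis limsup_h : forall y : R, 0 < y ->
  (limf_esup (fun x : R => (h (x * y) / h x)%:E) +oo%R < +oo)%E.

Let mean_fin : mean F \is a fin_num.
Proof.
by rewrite ge0_fin_numE// meanE// integral_ge0.
Qed.

(** Dividing by the mean makes sense because F, being long-tailed, charges every
    neighbourhood of infinity. *)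
Lemma mean_gt0 : 0 < fine (mean F).
Proof.
near (pinfty_nbhs R) => x.
have x0 : 0 < x by near: x; exact: nbhs_pinfty_gt.
have hx : 0 < h x by near: x; exact: local_mass_gt0.
rewrite -lte_fin fineK//; apply: lt_le_trans (mean_ge_tail F_nonneg (ltW x0)).
rewrite -EFinM lte_fin mulr_gt0//; apply: lt_le_trans hx _.
by rewrite /h /local_mass mass_tail lerBlDr lerDl tail_ge0.
Unshelve. all: by end_near. Qed.

(** Dominated convergence applies to sequences, so x runs through an arbitrary
    sequence tending to infinity, shifted so that the domination holds from
    its first term on. *)
Lemma integral_mass_left : (fun x : R =>
    (\int[F]_(y in `]-oo, (x / 2)%R]) mass F (x - y) x) / h x) @ +oo -->
  fine (mean F).
Proof.
have [C [C0 hC]] := mass_left_bound llF limsup_h.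
have [A [_ hA]] : \forall x \near +oo, 0 < h x /\
    forall y, 0 <= y -> y <= x / 2 ->
    mass F (x - y) x <= C * (y + 1) * h x.
  near=> x; split; near: x => //; exact: local_mass_gt0.
apply/cvg_pinftyP => u uy.
have [N _ uA] : \forall n \near \oo, A < u n by move/cvgryPgt : uy => /(_ A).
rewrite -(cvg_shiftn N); set v := fun n => u (n + N)%N.
have vA n : A < v n by apply: uA; rewrite /= leq_addl.
have vy : v @ \oo --> +oo by rewrite (cvg_shiftn N u).
pose f n (y : R) := (mass F (v n - y) (v n) / h (v n)).
pose f_ n : R -> \bar R := (EFin \o f n) \_ `]-oo, (v n / 2)%R]%classic.
have h0 n : 0 < h (v n) by have [] := hA _ (vA n).
have mf n D : measurable D -> measurable_fun D (f n).
  move=> mD; apply: nondecreasing_measurable => // y z yz.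
  rewrite /f ler_pM2r ?invr_gt0// !mass_tail lerD2r tail_nonincreasing//.
  by rewrite lerD2l lerN2.
have mf_ n : measurable_fun setT (f_ n).
  apply/(measurable_restrictT _ _).1; first exact: measurable_itv.
  by apply/measurable_EFinP; apply: mf; exact: measurable_itv.
have f_cvg : {ae F, forall y, setT y -> f_ ^~ y @ \oo --> y%:E}.
  apply: (@filterS _ _ (ae_filter_ringOfSetsType F) _ _ _ (ae_nonneg F_nonneg)).
  move=> y y0 _; apply: cvg_EFin.
    by near=> n; rewrite /f_ patchE; case: ifPn.
  apply: (@cvg_trans _ (f ^~ y @ \oo)); last first.
    exact: cvg_comp vy (mass_left_ratio llF y0).
  apply: near_eq_cvg; near=> n.
  rewrite /f_ /= patchE mem_set//= in_itv/= ler_pdivlMr//.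
  by near: n; move/cvgryPge : vy; exact.
have f_bound : {ae F, forall y n, setT y ->
    (`|f_ n y| <= (C * (`|y| + 1))%:E)%E}.
  apply: (@filterS _ _ (ae_filter_ringOfSetsType F) _ _ _ (ae_nonneg F_nonneg)).
  move=> y y0 n _; rewrite /f_ patchE; case: ifPn => [/set_mem|_]; last first.
    by rewrite abse0 lee_fin mulr_ge0// ?addr_ge0// ltW.
  rewrite /= in_itv/= => yv; have [_ /(_ y y0 yv) fC] := hA _ (vA n).
  rewrite lee_fin /f ger0_norm; last first.
    by apply: divr_ge0; [rewrite mass_ge0// gerBl|exact: ltW].
  by rewrite ler_pdivrMr// (ger0_norm y0).
have g_int : F.-integrable setT (fun y : R => (C * (`|y| + 1))%:E).
  rewrite (_ : (fun y => _) = fun y : R => (C%:E * (`|y%:E| + 1%:E))%E)//.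
  apply: integrableZl => //; apply: integrableD => //.
    exact/integrable_abse/integrable_id.
  exact: finite_measure_integrable_cst.
have mid : measurable_fun setT (fun y : R => y%:E).
  by apply/measurable_EFinP; exact: measurable_id.
have [_ _] := @dominated_convergence _ (measurableTypeR R) R F setT measurableT
  f_ (fun y : R => y%:E) _ mf_ mid f_cvg g_int f_bound.
have -> : (\int[F]_(y in setT) y%:E)%E = (fine (mean F))%:E.
  by rewrite fineK// /mean unlock.
move=> /fine_cvg; apply: cvg_trans; apply: near_eq_cvg; near=> n.
rewrite /= -integral_mkcond -[LHS]/(\int[F]_(y in `]-oo, (v n / 2)%R]) f n y).
by rewrite /f RintegralZr//; exact: integrable_mass_left.
Unshelve. all: by end_near. Qed.

Hypothesis tail_half : asymp_negligible (fun x => tail F (x / 2) ^+ 2) h.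

Let excess x := tail (convolution F F) x - 2 * tail F x.

Lemma tail_excess : (fun x : R => excess x / h x) @ +oo -->
  (2 * fine (mean F) : R).
Proof.
have cross : (fun x : R => tail F x * tail F (x / 2) / h x) @ +oo --> (0 : R).
  apply: (squeeze_cvgr _ (cvg_cst 0) tail_half); near=> x.
  have hx : 0 < h x by near: x; exact: local_mass_gt0.
  have x0 : 0 <= x by near: x; exact: nbhs_pinfty_ge.
  rewrite divr_ge0 ?mulr_ge0 ?tail_ge0 ?(ltW hx)//=.
  rewrite ler_pM2r ?invr_gt0// expr2 ler_wpM2r ?tail_ge0//.
  by rewrite tail_nonincreasing//; lra.
apply: (cvg_near_eq (cvgD (cvgB (cvgMl_tmp (a := 2) integral_mass_left)
  (cvgMl_tmp (a := 2) cross)) tail_half)); first by rewrite mulr0 subr0 addr0.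
near=> x; rewrite /excess tail_convolutionB /=.
rewrite !fctE; ring.
Unshelve. all: by end_near. Qed.

(** F*F(x, x+t] = 2 F(x, x+t] + excess x - excess (x + t), and the two excesses
    cancel at the order of h, which is also the order of F(x, x+t]. *)
Lemma local_subexponential_of_excess t : 0 < t -> local_subexponential F t.
Proof.
move=> t0; split; first exact: llF.
have shifted : (fun x : R => excess (x + t) / h (x + t)) @ +oo -->
    (2 * fine (mean F) : R).
  by rewrite (cvg_shiftr t (fun x => excess x / h x)); exact: tail_excess.
have hs := local_mass_shift llF ltr01 (ltW t0).
have t_neq0 : t != 0 by rewrite gt_eqF.
have ht := local_mass_ratio llF (ltW t0).
rewrite /asymp_equiv.
apply: (cvg_near_eq (cvgD (cvg_cst (1 : R)) (cvgM (cvgB tail_excess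
  (cvgM shifted hs)) (cvgMl_tmp (a := 2^-1) (cvgV t_neq0 ht))))).
  by rewrite mulr1 subrr mul0r addr0.
near=> x.
have hx : h x != 0 by rewrite gt_eqF//; near: x; exact: local_mass_gt0.
have hxt : h (x + t) != 0.
  by rewrite gt_eqF//; near: x; exact: (cvg_addrr t (local_mass_gt0 llF ltr01)).
have mx : local_mass F t x != 0.
  by rewrite gt_eqF//; near: x; exact: local_mass_gt0.
have -> : local_mass (convolution F F) t x =
    2 * local_mass F t x + (excess x - excess (x + t)).
  by rewrite /excess /local_mass !mass_tail; ring.
rewrite !fctE /= -!/(h _); move: hx hxt mx.
move: (h x) (h (x + t)) (local_mass F t x) (excess x) (excess (x + t)).
move=> a b c d e a0 b0 c0.
by field; rewrite a0 b0 c0.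
Unshelve. all: by end_near. Qed.

End second_order_asymptotics.

Theorem corollary1 (R : realType) (F : probability (measurableTypeR R) R) :
  let h : R -> R := fun x => mass F x (x + 1) in
  on_nonneg F ->
  (forall t : R, 0 < t -> local_long_tailed F t) ->
  (mean F < +oo)%E ->
  asymp_negligible (fun x => tail F (x / 2) ^+ 2) h ->
  (forall y : R, 0 < y ->
     (limf_esup (fun x : R => (h (x * y) / h x)%:E) +oo%R < +oo)%E) ->
  second_order_subexponential F.
Proof.
move=> h F_nonneg llF mean_lty tail_half limsup_h.
split => //; first exact: local_subexponential_of_excess.
have mu0 := mean_gt0 F_nonneg llF mean_lty.
have mu_neq0 : 2 * fine (mean F) != 0 by rewrite gt_eqF// mulr_gt0.
rewrite /asymp_equiv.
apply: (cvg_near_eq (cvgMr_tmp (b := (2 * fine (mean F))^-1)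
  (tail_excess F_nonneg llF mean_lty limsup_h tail_half))).
  by rewrite divff.
apply: nearW => x /=.
by rewrite -[LHS]mulrA -invfM; congr (_ / _); rewrite mulrC.
Qed.
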